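(* Let $n\ge 1$ and let $f_1,\dots,f_n\colon\mathbb{S}^n\to\mathbb{R}$ be continuous functions on the standard Euclidean sphere $\mathbb{S}^n\subset\mathbb{R}^{n+1}$. Then there exists a point $x\in\mathbb{S}^n$ with $f_i(x)=f_i(-x)$ for all $i=1,\dots,n$ such that for every $\varepsilon>0$ there are continuous paths $a,b\colon[0,1]\to\mathbb{S}^n$ with $a(0)=x$, $b(0)=-x$, $a(1)=b(1)$, and $|f_i(a(t))-f_i(b(t))|<\varepsilon$ for all $t\in[0,1]$ and all $i=1,\dots,n$. *)

(* Defs.v *)
From mathcomp Require Export all_boot all_order all_algebra.
From mathcomp Require Export all_classical all_reals all_analysis.
Export Order.TTheory GRing.Theory Num.Theory numFieldNormedType.Exports.

Set Implicit Arguments.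
Unset Strict Implicit.
Unset Printing Implicit Defensive.

Local Open Scope ring_scope.
Local Open Scope classical_set_scope.

(* The library norm `|x| on row vectors is the sup norm, so the Euclidean norm
   is spelled out here.  Both norms induce the canonical topology of 'rV[R]_m,
   so continuity needs no adjustment. *)
Definition eucl_norm (R : realType) (m : nat) (x : 'rV[R]_m) : R :=
  Num.sqrt (\sum_(i < m) x ord0 i ^+ 2).

Definition sphere (R : realType) (n : nat) : set 'rV[R]_n.+1 :=
  [set x | eucl_norm x = 1].
Arguments sphere R n : clear implicits.

(* A path in S is a total function on R of which only the restriction to
   [0, 1] matters. *)
Definition path_in (R : realType) (T : topologicalType) (S : set T)
    (a : R -> T) : Prop :=
  {within `[0, 1], continuous a} /\ (forall t, `[0, 1] t -> S (a t)).

(* Main.v *)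
Require Import Defs.
From mathcomp Require Import all_boot all_order all_algebra.
From mathcomp Require Import all_classical all_reals all_analysis.
From mathcomp Require Import zify ring lra.

Set Implicit Arguments.
Unset Strict Implicit.
Unset Printing Implicit Defensive.

(** Why the theorem is true.  For a fixed point N of the sphere, consider pairs
    of points of the form m + s u and m - s u, where u is a unit vector, m is
    t times the part of N orthogonal to u, and s is such that |m|^2 + s^2 = 1.
    At t = 0 these are the antipodal pairs; at t = 1 one member of the pair is
    N, and both are when u is orthogonal to N.  Replacing u by - u swaps the
    two members, so the difference of the values of f at them is a map G from
    S^n x [0, 1] to R^n that is odd in u.

    For generic f the zeros of G form arcs.  Those with both ends at t = 0 are
    permuted freely by the antipode and use up a number of zeros divisible by
    four, whereas the number of zeros at t = 0 is twice an odd number (this is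
    the theorem of Borsuk and Ulam).  So some arc leads from an antipodal pair
    at t = 0 to t = 1.  When N maximises one coordinate of f on the sphere,
    adding a small multiple of the inner product of N and u to that
    coordinate of G makes it vanish at t = 1 only where u is orthogonal to N,
    so the arc ends at the diagonal pair (N, N).

    To avoid genericity, this is carried out for a triangulated cylinder over
    the boundary of a cube in Z^(n+1), and for near-zeros.  A lattice point
    is labelled by a coordinate in which G is not small, with its sign; where
    all of G is small it gets a label beyond the n-th, read off a face of the
    cube that contains it.  The labelling is odd and never gives opposite
    labels to neighbours, as in the lemmas of Tucker and Fan.  The count modulo
    2 of n-simplices whose sorted labels alternate in sign starting with a plus
    is odd at t = 0 [parity_fan_sphere], and each of these simplices contains a
    near-zero.  The count restricted to simplices meeting the near-zeros that
    are reachable from t = 0 is the same on both ends of the cylinder, since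
    the interior contributes in antipodal pairs; hence some near-zero at t = 1
    is reachable [reachable_top].  Joining the near-zeros by segments gives, for
    every e > 0, an antipodal pair joined to (N, N) by a path on which f varies
    by less than e between the two members [crossing].  An accumulation point
    of these pairs as e tends to 0 works for all e at once, since it can be
    joined by a short segment to a pair that works for a smaller e. *)

(** * Chains modulo 2 *)

(** A chain is a list of simplices, and a simplex a list of vertices.  Chains
    are compared only through the parities of cochains on them, which makes the
    list a formal sum with coefficients modulo 2. *)
Definition parity (T : Type) (phi : T -> bool) (c : seq T) : bool :=
  \big[addb/false]_(s <- c) phi s.

Fixpoint faces {T : Type} (s : seq T) : seq (seq T) :=
  if s is v :: s' then s' :: map (cons v) (faces s') else [::].

Lemma parity_map (T U : Type) (phi : U -> bool) (F : T -> U) c :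
  parity phi (map F c) = parity (phi \o F) c.
Proof. exact: big_map. Qed.

Lemma faces_map (T U : Type) (h : T -> U) s :
  faces (map h s) = map (map h) (faces s).
Proof. by elim: s => //= v s ->; rewrite -!map_comp. Qed.

Section Chains.
Variable T : Type.
Implicit Types (phi : seq T -> bool) (c : seq (seq T)) (s : seq T) (h : T -> T).

Definition boundary c := flatten (map faces c).

(** The standard triangulation of the product of a simplex and an interval: the
    simplices v_0 .. v_i h(v_i) .. h(v_k). *)
Fixpoint prism h s : seq (seq T) :=
  if s is v :: s' then (v :: map h s) :: map (cons v) (prism h s') else [::].

(** Prisms from c to h(c), from h(c) to h(h(c)), up to the m-th iterate of h. *)
Fixpoint cylinder h m c : seq (seq T) :=
  if m is m'.+1 then flatten (map (prism h) c) ++ cylinder h m' (map (map h) c)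
  else [::].

Lemma parity_nil phi : parity phi [::] = false.
Proof. exact: big_nil. Qed.

Lemma parity_cons phi s c : parity phi (s :: c) = phi s (+) parity phi c.
Proof. exact: big_cons. Qed.

Lemma parity_cat phi c c' : parity phi (c ++ c') = parity phi c (+) parity phi c'.
Proof. exact: big_cat. Qed.

Lemma parity_flatten phi (F : seq T -> seq (seq T)) c :
  parity phi (flatten (map F c)) = parity (fun s => parity phi (F s)) c.
Proof.
by elim: c => [|s c IH] /=; rewrite ?parity_nil // parity_cat IH parity_cons.
Qed.

Lemma parity_addb phi psi c :
  parity (fun s => phi s (+) psi s) c = parity phi c (+) parity psi c.
Proof. exact: big_split. Qed.

Lemma eq_parity phi psi c : phi =1 psi -> parity phi c = parity psi c.
Proof. by move=> e; apply: eq_bigr => s _. Qed.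

Lemma parity_boundary phi c :
  parity phi (boundary c) = parity (fun s => parity phi (faces s)) c.
Proof. exact: parity_flatten. Qed.

Lemma boundary_map h c : boundary (map (map h) c) = map (map h) (boundary c).
Proof.
rewrite /boundary map_flatten -!map_comp; congr flatten.
by apply: eq_map => s /=; rewrite faces_map.
Qed.

Lemma parity_faces_cons phi v s :
  parity phi (faces (v :: s)) = phi s (+) parity (fun r => phi (v :: r)) (faces s).
Proof. by rewrite /= parity_cons parity_map. Qed.

Lemma boundary_faces phi s : parity phi (boundary (faces s)) = false.
Proof.
elim: s phi => [|v s IH] phi; first by rewrite parity_nil.
rewrite parity_boundary /= parity_cons parity_map.
rewrite (eq_parity _ (parity_faces_cons phi v)) parity_addb.
by rewrite addbA addbb -parity_boundary IH.
Qed.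

Lemma boundary_boundary phi c : parity phi (boundary (boundary c)) = false.
Proof.
rewrite !parity_boundary [LHS]/parity big1 // => s _.
by rewrite -parity_boundary boundary_faces.
Qed.

(** The prism operator is a chain homotopy between the identity and h. *)
Lemma boundary_prism phi h s :
  parity phi (boundary (prism h s)) (+) parity phi (flatten (map (prism h) (faces s)))
  = phi s (+) phi (map h s).
Proof.
elim: s phi => [|v s IH] phi; first by rewrite /boundary /= !parity_nil !addbb.
pose phiv r := phi (v :: r).
have E1 : parity phi (boundary (prism h (v :: s))) =
    phi (map h (v :: s)) (+) (phiv (map h s) (+)
      parity (fun r => phiv (h v :: map h r)) (faces s)) (+)
    (parity phi (prism h s) (+) parity phiv (boundary (prism h s))).
  rewrite /boundary [map faces _]/= [flatten _]/= -/(boundary _).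
  rewrite !parity_cons parity_cat !parity_map faces_map parity_map.
  rewrite parity_boundary parity_map (eq_parity _ (parity_faces_cons phi v)) parity_addb.
  by rewrite -parity_boundary -!addbA.
have E2 : parity phi (flatten (map (prism h) (faces (v :: s)))) =
    parity phi (prism h s) (+) (parity (fun r => phiv (h v :: map h r)) (faces s) (+)
      parity phiv (flatten (map (prism h) (faces s)))).
  rewrite /= parity_cat; congr (_ (+) _).
  rewrite !parity_flatten parity_map -parity_addb; apply: eq_parity => r /=.
  by rewrite parity_cons parity_map.
have IHv : parity phiv (boundary (prism h s)) =
    phiv s (+) phiv (map h s) (+) parity phiv (flatten (map (prism h) (faces s))).
  by rewrite -IH -addbA addbb addbF.
rewrite E1 E2 {}IHv /phiv.
move: (phi _) (phi _) (phi _) (parity _ _) (parity _ _) (parity _ _).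
by move=> [] [] [] [] [] [].
Qed.

(** The cylinder is additive over the simplices of its base; in particular it
    depends on the base only as a chain modulo 2. *)
Lemma parity_cylinder phi h m c :
  parity phi (cylinder h m c) = parity (fun s => parity phi (cylinder h m [:: s])) c.
Proof.
elim: m c => [|m IH] c /=.
  by rewrite /parity big_nil big1.
under [RHS]eq_parity => s do rewrite parity_cat /= cats0.
by rewrite parity_addb parity_cat parity_flatten IH parity_map.
Qed.

Lemma boundary_cylinder phi h m c :
  parity phi (boundary (cylinder h m c)) =
  parity phi c (+) parity phi (map (map (iter m h)) c)
  (+) parity phi (cylinder h m (boundary c)).
Proof.
elim: m c => [|m IH] c.
  by rewrite (eq_map (map_id (T := T))) map_id addbb /boundary /= parity_nil.
rewrite [cylinder _ _ _]/= parity_boundary parity_cat -!parity_boundary {}IH.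
rewrite [cylinder _ m.+1 _]/= parity_cat boundary_map.
have -> : [seq [seq iter m h i | i <- i] | i <- [seq [seq h i | i <- i] | i <- c]]
   = [seq [seq iter m.+1 h i | i <- i] | i <- c].
  rewrite -map_comp; apply: eq_map => s /=; rewrite -map_comp.
  by apply: eq_map => v /=; rewrite -iterSr.
have -> : parity phi (boundary (flatten (map (prism h) c))) =
    parity phi c (+) parity phi (map (map h) c)
    (+) parity phi (flatten (map (prism h) (boundary c))).
  rewrite parity_map [parity phi (flatten _) in RHS]parity_flatten.
  rewrite (parity_boundary _ c) -!parity_addb.
  rewrite parity_boundary (parity_flatten _ (prism h)); apply: eq_parity => s /=.
  by rewrite -boundary_prism -parity_boundary -parity_flatten -addbA addbb addbF.
move: (parity _ _) (parity _ _) (parity _ _) (parity _ _) (parity _ _).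
by move=> [] [] [] [] [].
Qed.

Lemma parity_cylinder_cat phi h m c c' :
  parity phi (cylinder h m (c ++ c')) =
  parity phi (cylinder h m c) (+) parity phi (cylinder h m c').
Proof. by rewrite parity_cylinder parity_cat -!parity_cylinder. Qed.

Lemma prism_map h g s : (forall v, h (g v) = g (h v)) ->
  prism h (map g s) = map (map g) (prism h s).
Proof.
move=> hg; elim: s => //= v s ->; rewrite hg -!map_comp; congr (_ :: _).
by congr [:: _, _ & _]; apply: eq_map => u /=.
Qed.

Lemma cylinder_map h g m c : (forall v, h (g v) = g (h v)) ->
  cylinder h m (map (map g) c) = map (map g) (cylinder h m c).
Proof.
move=> hg; elim: m c => //= m IH c; rewrite map_cat -IH map_flatten -!map_comp.
congr (flatten _ ++ cylinder h m _); apply: eq_map => s /=; first exact: prism_map.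
by rewrite -!map_comp; apply: eq_map => u /=.
Qed.

(** * Cubes, spheres and hemispheres *)

(** For translations tau_0, tau_1, .. along the axes of a lattice and the central
    symmetry nu, the chain [cube k] triangulates [-m, m]^k, and [cube_sphere k]
    its boundary.  The latter is built from hemispheres, and not as the list
    [boundary (cube k)], in order to have no simplex inside the cube: this
    matters because labels are odd only on the surface.  The sphere of the
    cube of dimension 0 is the empty simplex. *)
Section Spheres.
Variables (o : T) (nu : T -> T) (tau : nat -> T -> T) (m : nat).
Hypothesis nuK : involutive nu.
Hypothesis nu_o : nu o = o.

Fixpoint cube k : seq (seq T) :=
  if k is k'.+1 then
    let half := cylinder (tau k') m (cube k') in half ++ map (map nu) half
  else [:: [:: o]].

(** The half of the surface of [-m, m]^(k+1) where the last coordinate is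
    nonnegative, when c is the surface of [-m, m]^k: the side and the lid. *)
Definition hemisphere_over k c :=
  cylinder (tau k) m c ++ map (map (iter m (tau k))) (cube k).

Fixpoint cube_sphere k : seq (seq T) :=
  if k is k'.+1 then
    let upper := hemisphere_over k' (cube_sphere k') in upper ++ map (map nu) upper
  else [:: [::]].

Definition hemisphere k := hemisphere_over k (cube_sphere k).

Lemma parity_cube_antipode phi k :
  parity (phi \o map nu) (cube k) = parity phi (cube k).
Proof.
case: k => [|k]; first by rewrite /= !parity_cons !parity_nil /= nu_o.
rewrite /= !parity_cat !parity_map addbC; congr (_ (+) _).
by apply: eq_parity => s /=; rewrite (mapK nuK).
Qed.

(** Each half of the cube is bounded by its hemisphere and by the equatorial cube;
    the latter is invariant under nu, hence cancels between the two halves. *)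
Lemma parity_cube_sphere phi k :
  parity phi (cube_sphere k) = parity phi (boundary (cube k)).
Proof.
elim: k phi => [|k IH] phi; first by rewrite /= !parity_cons.
have half psi : parity psi (boundary (cylinder (tau k) m (cube k))) =
    parity psi (cube k) (+) parity psi (hemisphere k).
  rewrite boundary_cylinder /hemisphere /hemisphere_over parity_cat.
  rewrite [in RHS]parity_cylinder IH -[in RHS]parity_cylinder.
  by rewrite -!addbA; congr (_ (+) _); rewrite addbC.
rewrite [cube_sphere _]/= [cube _]/= -/(hemisphere k) parity_cat parity_map.
rewrite parity_boundary parity_cat -!parity_boundary.
rewrite half parity_boundary parity_map /=.
under [X in _ = _ (+) X]eq_parity => s do rewrite /= faces_map parity_map.
rewrite -parity_boundary half parity_cube_antipode.
by case: (parity _ _) (parity _ _) (parity _ _) => [] [] [].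
Qed.

Lemma boundary_cube_sphere phi k : parity phi (boundary (cube_sphere k)) = false.
Proof.
by rewrite parity_boundary parity_cube_sphere -parity_boundary boundary_boundary.
Qed.

Lemma boundary_hemisphere phi k :
  parity phi (boundary (hemisphere k)) = parity phi (cube_sphere k).
Proof.
rewrite parity_boundary parity_cat -!parity_boundary boundary_cylinder boundary_map.
rewrite [parity phi (map _ (boundary _))]parity_map -parity_cube_sphere parity_map.
rewrite (parity_cylinder _ _ _ (boundary _)) boundary_cube_sphere addbF.
by rewrite -addbA addbb addbF.
Qed.

End Spheres.

End Chains.

(** * Alternating simplices *)

(** A signed label is encoded by a natural number: its half is the index of the
    label and its parity the sign, an odd number being positive. *)
Section Labels.
Implicit Types (s t : seq nat) (c : nat).

Definition opp_label c := if odd c then c.-1 else c.+1.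

(** Two labels with the same index have the same sign. *)
Definition no_opposite s := {in s &, forall c c', c./2 = c'./2 -> c = c'}.

Fixpoint alternates b s :=
  if s is c :: s' then (odd c == b) && alternates (~~ b) s' else true.

(** The indicator of the alternating simplices of Fan: once sorted, the labels
    have alternating signs and the first is positive. *)
Definition fan s := alternates true (sort leq s).

Lemma odd_opp_label c : odd (opp_label c) = ~~ odd c.
Proof. by rewrite /opp_label; case: c => [|c] //=; case E: (odd c); rewrite /= ?E. Qed.

Lemma half_opp_label c : (opp_label c)./2 = c./2.
Proof.
rewrite -[in LHS](odd_double_half c) /opp_label oddD odd_double addbF oddb.
by case: (odd c); rewrite /= ?doubleK ?uphalf_double.
Qed.

Lemma opp_label_bit (b : bool) k : opp_label (b + k.*2) = ~~ b + k.*2.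
Proof.
by rewrite -[LHS]odd_double_half odd_opp_label half_opp_label half_bit_double
  oddD odd_double addbF oddb.
Qed.

Lemma alternates_opp b s : alternates b (map opp_label s) = alternates (~~ b) s.
Proof.
by elim: s b => //= c s IH b; rewrite IH odd_opp_label; case: (odd c); case: b.
Qed.

(** Dropping the first or the last label of an alternating list leaves an
    alternating list, and no other deletion does; in a list that is not
    alternating, the deletions that work go in pairs. *)
Lemma parity_faces_alternates b s :
  parity (alternates b) (faces s) = alternates true s (+) alternates false s.
Proof.
elim: s b => [|c s IH] b; first by rewrite parity_nil.
rewrite parity_faces_cons /=.
have -> : parity (fun r => (odd c == b) && alternates (~~ b) r) (faces s) =
   (odd c == b) && parity (alternates (~~ b)) (faces s).
  by case: (_ == _) => //=; rewrite /parity big1.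
rewrite IH; case: (odd c); case: b => /=; rewrite ?addbF //.
  by rewrite addbA addbb.
by rewrite addbC -addbA addbb addbF.
Qed.

(** A cochain blind to the order of the vertices cannot tell which of two equal
    vertices was dropped. *)
Lemma parity_faces_rem (E : eqType) (phi : seq E -> bool) (s : seq E) :
    (forall r r', perm_eq r r' -> phi r = phi r') ->
  parity phi (faces s) = \big[addb/false]_(x <- s) phi (rem x s).
Proof.
elim: s phi => [|v s IH] phi phiP; first by rewrite parity_nil big_nil.
rewrite parity_faces_cons big_cons /= eqxx; congr (_ (+) _).
rewrite IH => [|r r' rr']; last by apply: phiP; rewrite perm_cons.
rewrite big_seq [RHS]big_seq; apply: eq_bigr => x xs.
case: eqP => // ->; apply: phiP; rewrite perm_sym; exact: perm_to_rem.
Qed.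

Lemma perm_parity_faces (E : eqType) (phi : seq E -> bool) (s t : seq E) :
    (forall r r', perm_eq r r' -> phi r = phi r') -> perm_eq s t ->
  parity phi (faces s) = parity phi (faces t).
Proof.
move=> phiP st; rewrite !parity_faces_rem // (perm_big _ st) /=.
rewrite big_seq [RHS]big_seq; apply: eq_bigr => x xt; apply: phiP.
have xs : x \in s by rewrite (perm_mem st).
rewrite -(perm_cons x); apply: perm_trans (perm_to_rem xt).
by rewrite perm_sym; apply: perm_trans (perm_to_rem xs); rewrite perm_sym.
Qed.

Lemma mem_faces (E : eqType) (s r : seq E) : r \in faces s -> subseq r s.
Proof.
elim: s r => //= v s IH r; rewrite inE => /predU1P[->|/mapP[r' /IH r's ->]].
  exact: subseq_cons.
by rewrite eqxx.
Qed.

Lemma size_faces (E : eqType) (s r : seq E) : r \in faces s -> size s = (size r).+1.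
Proof.
elim: s r => //= v s IH r; rewrite inE => /predU1P[->//|/mapP[r' /IH -> ->]].
by [].
Qed.

Lemma fan_perm s t : perm_eq s t -> fan s = fan t.
Proof.
by move=> st; congr alternates; apply/perm_sortP: st => //;
  [exact: leq_total|exact: leq_trans|exact: anti_leq].
Qed.

Lemma sub_no_opposite s t : {subset s <= t} -> no_opposite t -> no_opposite s.
Proof. by move=> st h c c' /st cs /st c's; apply: h. Qed.

(** Without opposite labels, taking opposites preserves the sorted order. *)
Lemma fan_opposite s : no_opposite s ->
  fan (map opp_label s) = alternates false (sort leq s).
Proof.
move=> so; rewrite -[false]/(~~ true) -alternates_opp; congr alternates.
apply: (sorted_eq leq_trans anti_leq).
- exact: sort_sorted leq_total _.
- have := sort_sorted leq_total s.
  apply: homo_sorted_in (allss _) => c c' /=; rewrite !mem_sort => cs c's cc'.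
  have [-> //|ne] := eqVneq c c'.
  have : c./2 < c'./2.
    rewrite ltn_neqAle half_leq // andbT; apply: contraNneq ne => /so -> //.
  have opp_labelE x : opp_label x = ~~ odd x + (x./2).*2.
    by rewrite -{1}(odd_double_half x) opp_label_bit.
  rewrite -leq_double doubleS !opp_labelE => lt.
  apply: leq_trans (leq_trans lt (leq_addl _ _)).
  by case: (odd c); rewrite /= ?leqnSn // leqW.
- by rewrite perm_sort perm_map // perm_sym perm_sort.
Qed.

(** The coboundary of Fan's indicator is the sum of the indicator and of its
    image under the change of signs. *)
Lemma parity_faces_fan s : no_opposite s ->
  parity fan (faces s) = fan s (+) fan (map opp_label s).
Proof.
move=> so; rewrite fan_opposite // -(parity_faces_alternates true).
rewrite (perm_parity_faces fan_perm (t := sort leq s));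
  last by rewrite perm_sym perm_sort.
rewrite /parity big_seq [RHS]big_seq; apply: eq_bigr => r /mem_faces rs.
rewrite /fan (sorted_sort leq_trans) //.
exact: (subseq_sorted leq_trans) rs (sort_sorted leq_total _).
Qed.

(** In an alternating list the indices increase strictly, since consecutive labels
    differ in sign and are not opposite; so they cannot all be below n. *)
Lemma fan_large n s : no_opposite s -> n < size s -> fan s ->
  exists2 c, c \in s & n <= c./2.
Proof.
move=> so sn fs; have [/hasP//|/hasPn small] := boolP (has (fun c => n <= c./2) s).
move: sn; rewrite ltnNge => /negP[].
have [st srt] : no_opposite (sort leq s) /\ sorted leq (sort leq s).
  split; last exact: sort_sorted leq_total _.
  by apply: sub_no_opposite so => c; rewrite mem_sort.
have altS b t : no_opposite t -> sorted leq t -> alternates b t ->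
    sorted ltn (map half t).
  elim: t b => //= c [//|c' t] IH b to /= /andP[cc' sct] /and3P[/eqP ob /eqP oc' alt].
  apply/andP; split; last first.
    apply: (IH (~~ b)) => //; last by rewrite /= oc' eqxx.
    by apply: sub_no_opposite to => x xt; rewrite inE xt orbT.
  rewrite ltn_neqAle half_leq // andbT; apply/eqP => cc'2.
  have e : c = c' by apply: to; rewrite ?inE ?eqxx ?orbT.
  by move: oc'; rewrite -e ob; case: (b).
have := altS _ _ st srt fs; move=> /(sorted_uniq ltn_trans ltnn) U.
have := uniq_leq_size U (s2 := iota 0 n).
rewrite size_map size_sort size_iota; apply=> k /mapP[c]; rewrite mem_sort => cs ->.
by rewrite mem_iota /= add0n ltnNge small.
Qed.

End Labels.

(** * The triangulated cylinder over the surface of a cube *)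

Lemma mem_prism (E : eqType) (h : E -> E) (s r : seq E) : r \in prism h s ->
  size r = (size s).+1 /\ {in r, forall v, exists2 u, u \in s & v = u \/ v = h u}.
Proof.
elim: s r => //= v s IH r; rewrite inE => /predU1P[->|/mapP[r' /IH[sz r's] ->]].
  split=> [|w]; first by rewrite /= size_map.
  rewrite !inE => /or3P[/eqP->|/eqP->|/mapP[u us ->]].
  - by exists v; [rewrite inE eqxx|left].
  - by exists v; [rewrite inE eqxx|right].
  - by exists u; [rewrite inE us orbT|right].
split=> [|w]; first by rewrite /= sz.
rewrite inE => /predU1P[->|/r's[u us wu]]; first by exists v; [rewrite inE eqxx|left].
by exists u => //; rewrite inE us orbT.
Qed.

Lemma mem_cylinder (E : eqType) (h : E -> E) m c (r : seq E) : r \in cylinder h m c ->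
  exists2 s, s \in c & exists2 i, i < m & size r = (size s).+1 /\
    {in r, forall v, exists2 u, u \in s & v = iter i h u \/ v = iter i.+1 h u}.
Proof.
elim: m c => //= m IH c; rewrite mem_cat => /orP[/flattenP[p /mapP[s sc ->]]|].
  by move=> /mem_prism[sz rs]; exists s => //; exists 0.
move=> /IH[_ /mapP[s sc ->] [i im [sz rs]]]; exists s => //; exists i.+1 => //.
split=> [|v /rs[_ /mapP[u us ->]]]; first by rewrite sz size_map.
by rewrite -!iterSr => vu; exists u.
Qed.

Section Lattice.
Variable n : nat.
Local Notation V := ('rV[int]_n.+1 * nat)%type.
Implicit Types (u v : V) (s r : seq V).

(** A vertex is a lattice point together with a level, the discrete version of the
    parameter t; the antipode preserves the level. *)
Definition antipode v : V := (- v.1, v.2)%R.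
Definition raise v : V := (v.1, v.2.+1).
Definition step k v : V := (v.1 + \row_j (j == k :> nat)%:R, v.2)%R.
Definition origin : V := (0%R, 0).

Definition adjacent u v := (forall i, `|u.1 0 i - v.1 0 i| <= 1)%R /\
  (u.2 <= v.2.+1 /\ v.2 <= u.2.+1).

Definition on_cube m v :=
  (forall i, `|v.1 0 i| <= m%:Z)%R /\ (exists i, `|v.1 0 i| = m%:Z)%R.

Lemma antipodeK : involutive antipode.
Proof. by case=> x t; rewrite /antipode /= opprK. Qed.

Lemma adjacent_antipode u v : adjacent u v -> adjacent (antipode u) (antipode v).
Proof.
by case=> uv uv2; split=> // i; rewrite !mxE -opprD normrN.
Qed.

Lemma on_cube_antipode m v : on_cube m v -> on_cube m (antipode v).
Proof. by case=> vm [i vi]; split=> [j|]; [|exists i]; rewrite !mxE normrN. Qed.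

Lemma iter_step i k v j :
  (iter i (step k) v).1 0%R j = (v.1 0 j + ((j == k :> nat) * i)%N%:Z)%R.
Proof.
elim: i => [|i IH]; first by rewrite muln0 addr0.
by rewrite iterS mxE IH mxE -addrA mulnS addnC; case: (_ == _).
Qed.

Lemma iter_step_level i k v : (iter i (step k) v).2 = v.2.
Proof. by elim: i. Qed.

Lemma iter_raise i v : iter i raise v = (v.1, v.2 + i).
Proof. by elim: i => [|i /= ->]; [rewrite addn0; case: v|rewrite /raise addnS]. Qed.

Variable m : nat.

(** What the simplices of the cube of dimension k satisfy; the vanishing of the
    remaining coordinates is what keeps the vertices adjacent after a prism in
    the direction of the next axis. *)
Definition cube_simplex k s :=
  [/\ size s = k.+1, {in s &, forall u v, adjacent u v} &
   {in s, forall v, [/\ v.2 = 0, (forall i, `|v.1 0 i| <= m%:Z)%R &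
     forall i : 'I_n.+1, k <= i -> v.1 0%R i = 0%R]}].

Definition sphere_simplex k s :=
  [/\ size s = k, {in s &, forall u v, adjacent u v} &
   {in s, forall v, [/\ v.2 = 0, on_cube m v &
     forall i : 'I_n.+1, k <= i -> v.1 0%R i = 0%R]}].

Lemma adjacent_step k i s r :
    {in s &, forall u v, adjacent u v} ->
    {in s, forall v, forall j : 'I_n.+1, k <= j -> v.1 0%R j = 0%R} ->
    {in r, forall v, exists2 u, u \in s &
       v = iter i (step k) u \/ v = iter i.+1 (step k) u} ->
  {in r &, forall u v, adjacent u v}.
Proof.
move=> sn s0 rs v w /rs[v' v's vv'] /rs[w' w's ww'].
have [vwn vw2] := sn _ _ v's w's.
split; last by case: vv' => ->; case: ww' => ->; rewrite !iter_step_level.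
move=> j; have := vwn j; have := s0 _ v's j; have := s0 _ w's j.
by case: vv' => ->; case: ww' => ->; rewrite !iter_step; case: eqVneq => /=; lia.
Qed.

Local Notation cube := (cube origin antipode step m).
Local Notation cube_sphere := (cube_sphere origin antipode step m).

Lemma cube_simplexP k s : k <= n.+1 -> s \in cube k -> cube_simplex k s.
Proof.
elim: k s => [|k IH] s kn.
  rewrite inE => /eqP ->; split=> // [u v|v]; rewrite !inE.
    by move=> /eqP-> /eqP->; split=> // i; rewrite subrr.
  by move=> /eqP->; split=> // [i|i _]; rewrite mxE.
suff half r : r \in cylinder (step k) m (cube k) -> cube_simplex k.+1 r.
  rewrite /= mem_cat => /orP[/half//|/mapP[r /half[sz rn rc] ->]].
  split; first by rewrite size_map.
    by move=> _ _ /mapP[u ur ->] /mapP[v vr ->]; apply: adjacent_antipode; apply: rn.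
  move=> _ /mapP[v vr ->]; have [v2 vm v0] := rc _ vr.
  by split=> // i => [|/v0]; rewrite mxE ?normrN // => ->; rewrite oppr0.
move=> /mem_cylinder[t /(IH _ (ltnW kn))[tsz tn tc] [i im [sz rt]]].
split; first by rewrite sz tsz.
  by apply: adjacent_step tn _ rt => v /tc[].
move=> v /rt[u /tc[u2 um u0] vu].
split; first by case: vu => ->; rewrite iter_step_level.
  move=> j; have := um j; have := u0 j.
  by case: vu => ->; rewrite iter_step; case: eqVneq => /=; lia.
move=> j kj; have := u0 j.
by case: vu => ->; rewrite iter_step; case: eqVneq => /=; lia.
Qed.

Lemma hemisphere_simplexP k s : k <= n ->
    (forall r, r \in cube_sphere k -> sphere_simplex k r) ->
  s \in hemisphere origin antipode step m k -> sphere_simplex k.+1 s.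
Proof.
move=> kn IH; rewrite mem_cat => /orP[|/mapP[r /(cube_simplexP (leqW kn))]].
  move=> /mem_cylinder[t /IH[tsz tn tc] [i im [sz st]]].
  split; first by rewrite sz tsz.
    by apply: adjacent_step tn _ st => v /tc[].
  move=> v /st[u /tc[u2 [um [l ul]] u0] vu].
  split; first by case: vu => ->; rewrite iter_step_level.
    split=> [j|].
      have := um j; have := u0 j.
      by case: vu => ->; rewrite iter_step; case: eqVneq => /=; lia.
    (* If the coordinate l of modulus m were not among the first k, it would be 0,
       so m = 0; but then the cylinder is empty. *)
    exists l; rewrite -ul; case: (ltnP l k) => lk.
      by case: vu => ->; rewrite iter_step (ltn_eqF lk) addr0.
    have := u0 _ lk; move: ul im => + + ul0; rewrite ul0; lia.
  move=> j kj; have := u0 j.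
  by case: vu => ->; rewrite iter_step; case: eqVneq => /=; lia.
case=> sz rn rc ->; split; first by rewrite size_map.
  have /adjacent_step : {in [seq iter m (step k) v | v <- r], forall v,
      exists2 u, u \in r & v = iter m (step k) u \/ v = iter m.+1 (step k) u}.
    by move=> _ /mapP[u ur ->]; exists u => //; left.
  by apply=> // v /rc[].
move=> _ /mapP[v /rc[v2 vm v0] ->]; split; first by rewrite iter_step_level.
  split=> [j|].
    by have := vm j; have := v0 j; rewrite iter_step; case: eqVneq => /=; lia.
  by exists (Ordinal (kn : k < n.+1)); rewrite iter_step v0 // eqxx mul1n add0r.
by move=> j kj; have := v0 j; rewrite iter_step; case: eqVneq => /=; lia.
Qed.

Lemma sphere_simplex_antipode k s :
  sphere_simplex k s -> sphere_simplex k (map antipode s).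
Proof.
case=> sz sn sc; split; first by rewrite size_map.
  by move=> _ _ /mapP[u us ->] /mapP[v vs ->]; apply: adjacent_antipode; apply: sn.
move=> _ /mapP[v vs ->]; have [v2 vm v0] := sc _ vs.
split=> //; first exact: on_cube_antipode.
by move=> i /v0; rewrite mxE => ->; rewrite oppr0.
Qed.

Lemma sphere_simplexP k s : k <= n.+1 -> s \in cube_sphere k -> sphere_simplex k s.
Proof.
elim: k s => [|k IH] s kn; first by rewrite inE => /eqP->.
rewrite /= mem_cat => /orP[|/mapP[r + ->]].
  by apply: hemisphere_simplexP => // r; apply: IH; exact: ltnW.
move=> /(hemisphere_simplexP kn (fun r => IH r (ltnW kn))); exact: sphere_simplex_antipode.
Qed.

End Lattice.
Arguments antipode {n} v.
Arguments raise {n} v.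
Arguments step {n} k v.
Arguments origin {n}.

Section Reach.
Variables (n m M : nat).
Local Notation V := ('rV[int]_n.+1 * nat)%type.
Variable lab : V -> nat.
Implicit Types (u v : V) (s r : seq V).

Definition on_shell v := on_cube m v /\ v.2 <= M.

(** A vertex is good when the index of its label is at least n.  Reachable vertices
    are those that a chain of adjacent good vertices joins to level 0. *)
Inductive reachable : V -> Prop :=
| reachable_start v : on_shell v -> v.2 = 0 -> n <= (lab v)./2 -> reachable v
| reachable_step u v : reachable u -> adjacent u v -> on_shell v -> n <= (lab v)./2 ->
    reachable v.

Hypothesis lab_antipode : forall v, on_shell v -> lab (antipode v) = opp_label (lab v).
Hypothesis lab_adjacent : forall u v, on_shell u -> on_shell v -> adjacent u v ->
  (lab u)./2 = (lab v)./2 -> lab u = lab v.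

Lemma on_shell_antipode v : on_shell v -> on_shell (antipode v).
Proof. by case=> vm vM; split=> //; exact: on_cube_antipode. Qed.

Lemma reachable_antipode v : reachable v -> reachable (antipode v).
Proof.
elim=> {v} [v vS v0 vn|u v _ uF uv vS vn].
  apply: reachable_start => //; first exact: on_shell_antipode.
  by rewrite lab_antipode ?half_opp_label.
apply: reachable_step uF (adjacent_antipode uv) (on_shell_antipode vS) _.
by rewrite lab_antipode ?half_opp_label.
Qed.

Definition small_simplex s :=
  {in s &, forall u v, adjacent u v} /\ {in s, forall v, on_shell v}.

Definition fan_simplex s := fan (map lab s).

Definition reached s := has (fun v => `[< reachable v >]) s.

Lemma small_no_opposite s : small_simplex s -> no_opposite (map lab s).
Proof.
case=> sn sS _ _ /mapP[u us ->] /mapP[v vs ->].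
by apply: lab_adjacent; [exact: sS|exact: sS|exact: sn].
Qed.

Lemma small_antipode s : small_simplex s -> small_simplex (map antipode s).
Proof.
case=> sn sS; split=> [_ _ /mapP[u us ->] /mapP[v vs ->]|_ /mapP[v vs ->]].
  by apply: adjacent_antipode; apply: sn.
exact/on_shell_antipode/sS.
Qed.

Lemma lab_map_antipode s : small_simplex s ->
  map lab (map antipode s) = map opp_label (map lab s).
Proof.
by case=> _ sS; rewrite -!map_comp; apply/eq_in_map => v vs; exact/lab_antipode/sS.
Qed.

Lemma parity_faces_fan_simplex s : small_simplex s ->
  parity fan_simplex (faces s) = fan_simplex s (+) fan_simplex (map antipode s).
Proof.
move=> ss; rewrite /fan_simplex lab_map_antipode // -parity_faces_fan;
  last exact: small_no_opposite.
by rewrite faces_map parity_map.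
Qed.

Lemma reached_antipode s : reached (map antipode s) = reached s.
Proof.
rewrite /reached has_map; apply: eq_has => v /=; apply/asbool_equiv_eq.
by split=> [/reachable_antipode|/reachable_antipode//]; rewrite antipodeK.
Qed.

Lemma fan_simplex_big s : small_simplex s -> n < size s -> fan_simplex s ->
  exists2 v, v \in s & n <= (lab v)./2.
Proof.
move=> ss sz fs; have := fan_large (small_no_opposite ss) _ fs.
by rewrite size_map => /(_ _ sz)[_ /mapP[v vs ->]]; exists v.
Qed.

Local Notation cube_sphere := (cube_sphere (@origin n) antipode step m).
Local Notation hemisphere := (hemisphere (@origin n) antipode step m).

Lemma sphere_simplex_small k s : sphere_simplex m k s -> small_simplex s.
Proof. by case=> _ sn sc; split=> // v /sc[v0 vm _]; split; rewrite ?v0. Qed.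

(** The theorem of Borsuk and Ulam in the form of Fan.  On the sphere, which is a
    hemisphere and its image under the antipode, the parity is that of the
    coboundary of the indicator on the hemisphere, hence the parity on the
    equator; in dimension -1 it is 1. *)
Lemma parity_fan_sphere k : k <= n.+1 -> parity fan_simplex (cube_sphere k) = true.
Proof.
elim: k => [|k IH] kn; first by rewrite /= parity_cons parity_nil.
rewrite -{}(IH (ltnW kn)).
rewrite -[parity fan_simplex (cube_sphere k)](boundary_hemisphere _ _ (@antipodeK n));
  last by rewrite /antipode /origin /= oppr0.
rewrite [cube_sphere _]/= -/(hemisphere k) parity_cat parity_map -parity_addb.
rewrite parity_boundary /parity big_seq [RHS]big_seq.
apply: eq_bigr => s sc.
rewrite -[RHS]/(parity fan_simplex (faces s)) parity_faces_fan_simplex //.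
apply: (@sphere_simplex_small k.+1); apply: hemisphere_simplexP sc => // r.
exact/sphere_simplexP/ltnW.
Qed.

Local Notation shaft := (cylinder raise M).

Lemma shaft_small c s : s \in shaft c ->
    (forall r, r \in c -> sphere_simplex m n.+1 r) ->
  small_simplex s /\ size s = n.+2.
Proof.
move=> /mem_cylinder[r rc [i iM [sz sr]]] /(_ _ rc)[rz rn rS].
split; last by rewrite sz rz.
split=> [v w|v] /sr[v' v'r vv'].
  move=> /sr[w' w'r ww']; have [v'2 _ _] := rS _ v'r; have [w'2 _ _] := rS _ w'r.
  have [vw _] := rn _ _ v'r w'r; move: v'2 w'2 vw.
  by case: vv' => ->; case: ww' => ->; rewrite /adjacent !iter_raise /= => -> -> vw;
    split=> //; lia.
have [v'2 v'm _] := rS _ v'r.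
by case: vv' => ->; rewrite !iter_raise; split=> //=; rewrite v'2; lia.
Qed.

(** Weigh each simplex s of dimension n+1 of the cylinder by the parity of its
    alternating faces if s contains a reachable vertex, and by 0 otherwise.
    These weights are invariant under the antipode, so they sum to 0 modulo 2.  On the
    other hand an alternating face contains a good vertex; being adjacent to
    all vertices of s, that vertex is reachable as soon as one of them is.  So the
    condition on s can be read on the face, and the sum is the number of
    alternating simplices with a reachable vertex on the two ends of the
    cylinder.  There is an odd number of them at level 0. *)
Theorem reachable_top : exists2 v, reachable v & v.2 = M.
Proof.
apply: contrapT => noend.
have origin_antipode : antipode origin = origin :> V by rewrite /antipode /= oppr0.
have sphP s : s \in cube_sphere n.+1 -> sphere_simplex m n.+1 s by exact: sphere_simplexP.
have capP s : s \in hemisphere n -> sphere_simplex m n.+1 s.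
  by apply: hemisphere_simplexP => // r; exact: sphere_simplexP.
pose reached_fan r := reached r && fan_simplex r.
pose cnt s := reached s && parity fan_simplex (faces s).
have even : parity cnt (shaft (cube_sphere n.+1)) = false.
  rewrite [cube_sphere _]/= -/(hemisphere n) parity_cylinder_cat cylinder_map //.
  rewrite parity_map -parity_addb.
  rewrite /parity big_seq big1 // => s /shaft_small/(_ capP)[ss _].
  rewrite /= /cnt reached_antipode !parity_faces_fan_simplex //; last exact: small_antipode.
  by rewrite (mapK (@antipodeK n)) [X in _ && X]addbC addbb.
have localize : parity cnt (shaft (cube_sphere n.+1)) =
    parity reached_fan (boundary (shaft (cube_sphere n.+1))).
  rewrite parity_boundary /parity big_seq [RHS]big_seq; apply: eq_bigr => s.
  move=> /shaft_small/(_ sphP)[[sn sS] sz].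
  rewrite /cnt -[RHS]/(parity _ (faces s)) -[LHS]andbC.
  transitivity (parity (fun r => reached s && fan_simplex r) (faces s)).
    by case: (reached s); rewrite ?andbF ?andbT // /parity big1.
  rewrite /parity big_seq [RHS]big_seq; apply: eq_bigr => r rs.
  rewrite /reached_fan.
  have rsub := mem_subseq (mem_faces rs).
  case fr: (fan_simplex r); rewrite ?andbF ?andbT //.
  have [] := @fan_simplex_big r _ _ fr.
  - by split=> [u v /rsub us /rsub vs|v /rsub vs]; [exact: sn|exact: sS].
  - by have := size_faces rs; rewrite sz => -[<-].
  move=> v vr vn; apply/hasP/hasP => -[u us /asboolP uR].
    exists v => //; apply/asboolP; apply: reachable_step uR _ _ vn.
      by apply: sn => //; exact: rsub.
    exact/sS/rsub.
  by exists u; [exact: rsub|exact/asboolP].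
move: even; rewrite {}localize boundary_cylinder.
rewrite (parity_cylinder _ _ _ (boundary _)) boundary_cube_sphere //; last exact: antipodeK.
rewrite addbF.
have -> : parity reached_fan (map (map (iter M raise)) (cube_sphere n.+1)) = false.
  rewrite parity_map /parity big_seq big1 // => s /sphP[_ _ sc] /=.
  apply/negbTE; rewrite negb_and; apply/orP; left; apply/hasPn => _ /mapP[v vs ->].
  apply/asboolP => vR; apply: noend; exists (iter M raise v) => //.
  by rewrite iter_raise /=; have [-> _ _] := sc _ vs.
rewrite addbF.
have -> : parity reached_fan (cube_sphere n.+1) = parity fan_simplex (cube_sphere n.+1).
  rewrite /parity big_seq [RHS]big_seq; apply: eq_bigr => s /sphP sS.
  rewrite /reached_fan.
  case fs: (fan_simplex s); rewrite ?andbF // andbT.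
  have ss := sphere_simplex_small sS; case: sS => sz _ sc.
  have [] := fan_simplex_big ss _ fs; first by rewrite sz.
  move=> v vs vn; apply/hasP; exists v => //; apply/asboolP.
  by have [v0 _ _] := sc _ vs; apply: reachable_start => //; case: ss => _; apply.
by rewrite parity_fan_sphere.
Qed.

End Reach.

Local Open Scope ring_scope.
Local Open Scope classical_set_scope.

(** * Euclidean geometry of row vectors *)

Section Euclid.
Variables (R : realType) (n : nat).
Local Notation E := 'rV[R]_n.
Implicit Types (x y z : E) (k : R).

Definition dot x y : R := \sum_i x 0 i * y 0 i.

Lemma dotC x y : dot x y = dot y x.
Proof. by apply: eq_bigr => i _; rewrite mulrC. Qed.

Lemma dotDl x y z : dot (x + y) z = dot x z + dot y z.
Proof. by rewrite -big_split; apply: eq_bigr => i _; rewrite mxE mulrDl. Qed.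

Lemma dotZl k x y : dot (k *: x) y = k * dot x y.
Proof. by rewrite mulr_sumr; apply: eq_bigr => i _; rewrite mxE mulrA. Qed.

Lemma dotDr x y z : dot x (y + z) = dot x y + dot x z.
Proof. by rewrite dotC dotDl !(dotC x). Qed.

Lemma dotZr k x y : dot x (k *: y) = k * dot x y.
Proof. by rewrite dotC dotZl (dotC x). Qed.

Lemma dotNl x y : dot (- x) y = - dot x y.
Proof. by rewrite -scaleN1r dotZl mulN1r. Qed.

Lemma dotNr x y : dot x (- y) = - dot x y.
Proof. by rewrite dotC dotNl (dotC x). Qed.

Lemma eucl_normE x : eucl_norm x = Num.sqrt (dot x x).
Proof. by []. Qed.

Lemma dot_ge0 x : 0 <= dot x x.
Proof. by apply: sumr_ge0 => i _; rewrite -expr2 sqr_ge0. Qed.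

Lemma dot_gt0 x : x != 0 -> 0 < dot x x.
Proof.
move=> x0; rewrite lt_neqAle dot_ge0 andbT eq_sym; apply: contraNneq x0 => xx.
apply/eqP/rowP => i; rewrite mxE; apply/eqP; rewrite -sqrf_eq0 expr2; apply/eqP.
have /psumr_eq0P := xx; apply=> // j _; by rewrite -expr2 sqr_ge0.
Qed.

Lemma eucl_norm_gt0 x : x != 0 -> 0 < eucl_norm x.
Proof. by move=> /dot_gt0; rewrite eucl_normE sqrtr_gt0. Qed.

Lemma eucl_normN x : eucl_norm (- x) = eucl_norm x.
Proof. by rewrite !eucl_normE dotNl dotNr opprK. Qed.

Lemma coord_le_norm x i : `|x 0 i| <= `|x|.
Proof.
rewrite [leRHS]/Num.norm /= mx_normrE; apply/bigmax_geP; right => /=.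
by exists (0, i).
Qed.

Lemma norm_le_coord x k : 0 <= k -> (forall i, `|x 0 i| <= k) -> `|x| <= k.
Proof.
move=> k0 xk; rewrite [leLHS]/Num.norm /= mx_normrE; apply/bigmax_leP.
by split=> // -[i j] _ /=; rewrite ord1.
Qed.

Lemma coord_le_eucl x i : `|x 0 i| <= eucl_norm x.
Proof.
rewrite -sqrtr_sqr eucl_normE ler_sqrt ?dot_ge0 // /dot (bigD1 i) //= expr2 lerDl.
by apply: sumr_ge0 => j _; rewrite -expr2 sqr_ge0.
Qed.

Lemma norm_le_eucl x : `|x| <= eucl_norm x.
Proof. by apply: norm_le_coord => [|i]; [exact: sqrtr_ge0|exact: coord_le_eucl]. Qed.

Lemma dot_bound x : exists2 C, 0 < C & forall y, `|dot x y| <= C * `|y|.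
Proof.
exists (1 + \sum_i `|x 0 i|) => [|y].
  by rewrite ltr_pwDl //; apply: sumr_ge0.
apply: le_trans (ler_norm_sum _ _ _) _.
rewrite mulrDl mul1r mulr_suml; apply: ler_wpDl => //; apply: ler_sum => i _.
by rewrite normrM ler_wpM2l // coord_le_norm.
Qed.

Lemma continuous_coord i : continuous (fun x : E => x 0 i).
Proof. exact: coord_continuous. Qed.

Lemma sum_continuous (F : 'I_n -> E -> R) :
  (forall i, continuous (F i)) -> continuous (fun x => \sum_i F i x).
Proof.
move=> cF; apply: (@continuous_big R _ +%R 0 xpredT _ E _ F) => [|i _].
  by move=> w; apply: cvgD; [exact: cvg_fst|exact: cvg_snd].
exact: cF.
Qed.

Lemma dot_continuous x : continuous (dot x).
Proof.
apply: (@sum_continuous (fun i y => x 0 i * y 0 i)) => i y.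
by apply: (@cvgM _ _ (nbhs y) _ (fun=> x 0 i) (fun y : E => y 0 i));
  [exact: cvg_cst|exact: continuous_coord].
Qed.

Lemma eucl_norm_continuous : continuous (@eucl_norm R n).
Proof.
move=> y; apply: (@continuous_comp _ _ _ (fun x : E => dot x x) Num.sqrt).
  apply: (@sum_continuous (fun i x => x 0 i * x 0 i)) => i z.
  by apply: (@cvgM _ _ (nbhs z) _ (fun z : E => z 0 i) (fun z : E => z 0 i));
    exact: continuous_coord.
exact: sqrt_continuous.
Qed.

Definition unit_vec x : E := (eucl_norm x)^-1 *: x.

Lemma dot_unit x : x != 0 -> dot (unit_vec x) (unit_vec x) = 1.
Proof.
move=> x0; rewrite dotZl dotZr mulrA -invfM -expr2 eucl_normE sqr_sqrtr ?dot_ge0 //.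
by rewrite mulVf // gt_eqF // dot_gt0.
Qed.

Lemma unit_vecN x : unit_vec (- x) = - unit_vec x.
Proof. by rewrite /unit_vec eucl_normN scalerN. Qed.

Lemma unit_vec_continuous x : x != 0 -> {for x, continuous unit_vec}.
Proof.
move=> x0; apply: (@cvgZ _ _ _ (nbhs x) _ (fun y => (eucl_norm y)^-1) id);
  last exact: cvg_id.
apply: (@cvgV _ _ (nbhs x)); first by rewrite gt_eqF // eucl_norm_gt0.
exact: eucl_norm_continuous.
Qed.

End Euclid.

(** * From antipodal pairs to the diagonal *)

Section ShrinkingPair.
Variables (R : realType) (n : nat).
Local Notation E := 'rV[R]_n.+1.
Variable N : E.
Hypothesis NN : dot N N = 1.
Implicit Types (z : E * R).

(** The first member m + s u of the pair with parameters (y, t), where u is the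
    direction of y; the second member is the first one at (- y, t). *)
Definition tip z : E :=
  let u := unit_vec z.1 in let c := dot N u in
  z.2 *: (N - c *: u) + Num.sqrt (1 - z.2 ^+ 2 * (1 - c ^+ 2)) *: u.

Definition mirror z : E * R := (- z.1, z.2).

Lemma sphere_dot x : dot x x = 1 -> sphere R n x.
Proof. by move=> xx; rewrite /sphere /= eucl_normE xx sqrtr1. Qed.

Lemma tip_sphere z : z.1 != 0 -> 0 <= z.2 <= 1 -> sphere R n (tip z).
Proof.
case: z => y t /= y0 /andP[t0 t1]; apply: sphere_dot; rewrite /tip /=.
have := dot_unit y0; move: (unit_vec y) => u uu; set c := dot N u.
set s := Num.sqrt _.
have ss : s * s = 1 - t ^+ 2 * (1 - c ^+ 2).
  rewrite -expr2 sqr_sqrtr //; have : t ^+ 2 <= 1 by rewrite expr_le1.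
  have : 0 <= t ^+ 2 * c ^+ 2 by rewrite mulr_ge0 // sqr_ge0.
  lra.
rewrite !(dotDl, dotDr, dotZl, dotZr, dotNl, dotNr) NN uu (dotC u N) -/c.
transitivity (t ^+ 2 * (1 - c ^+ 2) + s * s); [ring|rewrite ss; ring].
Qed.

Lemma tip0 y : y != 0 -> tip (y, 0) = unit_vec y.
Proof. by move=> y0; rewrite /tip /= scale0r add0r expr0n mul0r subr0 sqrtr1 scale1r. Qed.

(** At t = 1 the vector m is N - c u and s = |c|, where c is the inner product of N
    and u. *)
Lemma tip1 y : 0 <= dot N (unit_vec y) -> tip (y, 1) = N.
Proof.
move=> c0; rewrite /tip /= expr1n mul1r opprB addrCA subrr addr0 sqrtr_sqr ger0_norm //.
by rewrite scale1r subrK.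
Qed.

Lemma tip_continuous z : z.1 != 0 -> {for z, continuous tip}.
Proof.
move=> y0.
have cu : (unit_vec x.1) @[x --> z] --> unit_vec z.1.
  apply: (@continuous_comp _ _ _ fst (@unit_vec R n.+1)); first exact: cvg_fst.
  exact: unit_vec_continuous.
have cc : (dot N (unit_vec x.1)) @[x --> z] --> dot N (unit_vec z.1).
  exact: (cvg_comp _ _ cu (@dot_continuous _ _ N _)).
have ct : x.2 @[x --> z] --> z.2 by exact: cvg_snd.
pose c (x : E * R) := dot N (unit_vec x.1).
have c2 : c x ^+ 2 @[x --> z] --> c z ^+ 2 by exact: (cvgM cc cc).
have t2 : x.2 ^+ 2 @[x --> z] --> z.2 ^+ 2 by exact: (cvgM ct ct).
have cs : 1 - x.2 ^+ 2 * (1 - c x ^+ 2) @[x --> z] --> 1 - z.2 ^+ 2 * (1 - c z ^+ 2).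
  by exact: (cvgB (cvg_cst (1 : R)) (cvgM t2 (cvgB (cvg_cst (1 : R)) c2))).
have cr := cvg_comp _ _ cs (@sqrt_continuous R _).
exact: (cvgD (cvgZ ct (cvgB (cvg_cst N) (cvgZ cc cu))) (cvgZ cr cu)).
Qed.

Lemma mirror_continuous : continuous mirror.
Proof.
move=> z; have h : - x.1 @[x --> z] --> - z.1 by apply: cvgN; exact: cvg_fst.
exact: (cvg_pair h cvg_snd).
Qed.

Lemma mirrorK : involutive mirror.
Proof. by case=> y t; rewrite /mirror /= opprK. Qed.

End ShrinkingPair.

(** * Paths of pairs with close values *)

(** Finitely many continuous functions on a compact set have a common modulus of
    uniform continuity. *)
Lemma heine (R : realType) (X : pseudoMetricType R) (K : set X) (I : finType)
    (g : I -> X -> R) : compact K ->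
    (forall i, {within K, continuous (g i)}) ->
  forall e : R, 0 < e -> exists2 d : R, 0 < d &
    forall x y, K x -> K y -> ball x d y -> forall i, `|g i x - g i y| < e.
Proof.
move=> /compact_near_coveringP cK cg e e0.
pose P (d : R) x := K x -> forall y, K y -> ball x d y ->
  forall i, `|g i x - g i y| < e.
have /cK : forall x, K x -> \forall x' \near x & d \near 0^'+, P d x'.
  move=> x Kx.
  have : \forall y \near within K (nbhs x), forall i, `|g i x - g i y| < e / 2.
    apply: filter_forall => i.
    have /subspace_continuousP/(_ x Kx)/cvgrPdist_lt := cg i.
    by apply; rewrite divr_gt0.
  rewrite near_withinE => /nbhs_ballP[r /= r0 rx].
  exists (ball x (r / 2), [set d | 0 < d < r / 2]).
    split=> /=; first by apply: nbhsx_ballx; rewrite divr_gt0.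
    near=> d; apply/andP; split; near: d; first exact: nbhs_right_gt.
    by apply: nbhs_right_lt; rewrite divr_gt0.
  case=> x' d /= [xx' /andP[d0 dr]] Kx' y Ky x'y i.
  have xx'r : ball x r x'.
    by apply: le_ball xx'; lra.
  have xyr : ball x r y by apply: (ball_split xx'); apply: le_ball x'y; exact: ltW.
  have h1 := rx _ xyr Ky i; have h2 := rx _ xx'r Kx' i.
  rewrite (_ : g i x' - g i y = (g i x - g i y) - (g i x - g i x')); last by ring.
  by apply: le_lt_trans (ler_normB _ _) _; lra.
move=> cov.
have [d [dP d0]] : exists d, (K `<=` P d) /\ 0 < d.
  near (0 : R)^'+ => d; exists d; split; first by near: d; exact: cov.
  by near: d; exact: nbhs_right_gt.
by exists d => // x y Kx Ky xy i; apply: dP.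
Unshelve. all: by end_near. Qed.

Section Links.
Variables (R : realType) (n : nat).
Local Notation E := 'rV[R]_n.+1.
Implicit Types (x y z w : E * R).

(** The parameters y on the unit sphere of the sup norm, thickened so as to contain
    the segments between neighbouring ones. *)
Definition collar : set (E * R) :=
  [set z | 2^-1 <= `|z.1| <= 2 /\ 0 <= z.2 <= 1].

Lemma collar_neq0 z : collar z -> z.1 != 0.
Proof.
case=> /andP[z1 _] _; apply: contraTneq z1 => ->.
by rewrite normr0 -ltNge invr_gt0.
Qed.

Lemma collar_mirror z : collar z -> collar (mirror z).
Proof. by case=> z1 z2; split=> //=; rewrite normrN. Qed.

Lemma compact_collar : compact collar.
Proof.
have -> : collar = [set y : E | 2^-1 <= `|y| <= 2] `*` `[0, 1].
  by apply/seteqP; split=> z /=; rewrite in_itv.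
apply: compact_setX; last exact: segment_compact.
apply: bounded_closed_compact.
  exists 2; split; first exact: num_real.
  by move=> M M2 y /andP[_ y2]; apply: le_trans y2 (ltW M2).
have -> : [set y : E | 2^-1 <= `|y| <= 2] = Num.norm @^-1` `[2^-1, 2].
  by apply/seteqP; split=> y /=; rewrite in_itv.
apply: closed_comp; last exact: interval_closed.
by move=> y _; exact: norm_continuous.
Qed.

Lemma modulus (I : finType) (g : I -> E * R -> R) :
    (forall i, {within collar, continuous (g i)}) ->
  forall e, 0 < e -> exists2 d, 0 < d <= 2^-1 & forall x y, collar x -> collar y ->
    `|x.1 - y.1| < d -> `|x.2 - y.2| < d -> forall i, `|g i x - g i y| < e.
Proof.
move=> cg e /(heine compact_collar cg)[d d0 dP].
exists (Num.min d 2^-1); first by rewrite lt_min d0 invr_gt0 ltr0n ge_min lexx orbT.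
move=> x y Kx Ky; rewrite !lt_min => /andP[xy1 _] /andP[xy2 _]; apply: dP => //.
by split; rewrite -ball_normE.
Qed.

Lemma within_comp_cvg (X Y Z : topologicalType) (A : set X) (B : set Y)
    (h : X -> Y) (g : Y -> Z) (a : X) :
    {for a, continuous h} -> (forall b, A b -> B (h b)) ->
    g @ within B (nbhs (h a)) --> g (h a) ->
  (g \o h) @ within A (nbhs a) --> g (h a).
Proof.
move=> ch AB cg U /cg; rewrite !nbhs_simpl /= => gU.
have := ch _ gU; rewrite nbhs_simpl /within /=.
by apply: filterS => b /= BU Ab; apply: BU; exact: AB.
Qed.

Variables (N : E) (I : finType) (f : I -> E -> R).
Hypothesis NN : dot N N = 1.
Hypothesis f_cont : forall i, {within sphere R n, continuous (f i)}.

Definition gap i z := f i (tip N z) - f i (tip N (mirror z)).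

Lemma gap_mirror i z : gap i (mirror z) = - gap i z.
Proof. by rewrite /gap mirrorK opprB. Qed.

Lemma gap_continuous i : {within collar, continuous (gap i)}.
Proof.
apply/subspace_continuousP => z Kz.
have cf w : collar w -> f i @ within (sphere R n) (nbhs (tip N w)) --> f i (tip N w).
  move=> Kw; have /subspace_continuousP := f_cont (i := i); apply.
  by apply: tip_sphere => //; [exact: collar_neq0|case: Kw].
have tipS w : collar w -> sphere R n (tip N w).
  by move=> Kw; apply: tip_sphere => //; [exact: collar_neq0|case: Kw].
have c1 := within_comp_cvg (tip_continuous (N := N) (collar_neq0 Kz)) tipS (cf _ Kz).
have c2 := within_comp_cvg (h := tip N \o @mirror R n) (A := collar) (a := z)
  _ _ (cf _ (collar_mirror Kz)).
apply: (cvgB c1 (c2 _ _)).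
  apply: continuous_comp; first exact: mirror_continuous.
  by apply: tip_continuous; apply: collar_neq0 (collar_mirror Kz).
by move=> w Kw; apply: tipS; exact: collar_mirror.
Qed.

Definition linked (e : R) z w := exists p : R -> E * R,
  [/\ continuous p, p 0 = z, p 1 = w & forall t : R, 0 <= t <= 1 ->
      collar (p t) /\ forall i, `|gap i (p t)| < e].

Lemma linked_le e e' z w : e <= e' -> linked e z w -> linked e' z w.
Proof.
move=> ee' [p [cp p0 p1 pP]]; exists p; split=> // t /pP[Kt gt]; split=> // i.
exact: lt_le_trans (gt i) ee'.
Qed.

Lemma linked_refl e z : collar z -> (forall i, `|gap i z| < e) -> linked e z z.
Proof. by move=> Kz ge; exists (fun=> z); split=> //; exact: cst_continuous. Qed.

(** Adding the two paths, each of them stopped while the other one moves, avoids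
    gluing. *)
Lemma linked_trans e z w x : linked e z w -> linked e w x -> linked e z x.
Proof.
move=> [p [cp p0 p1 pP]] [q [cq q0 q1 qP]].
pose lo (t : R) : R := Num.min 1 (2 * t); pose hi (t : R) : R := 2 * t - lo t.
have clo : continuous lo.
  move=> t; apply: continuous_min; first exact: cvg_cst.
  by apply: cvgM; [exact: cvg_cst|exact: cvg_id].
have chi : continuous hi.
  move=> t; apply: cvgB; last exact: clo.
  by apply: cvgM; [exact: cvg_cst|exact: cvg_id].
exists (fun t => p (lo t) + q (hi t) - w); split.
- move=> t; apply: cvgB; last exact: cvg_cst.
  by apply: cvgD; apply: continuous_comp; [exact: clo|exact: cp|exact: chi|exact: cq].
- have lo0 : lo 0 = 0 by rewrite /lo mulr0 min_r.
  have -> : hi 0 = 0 by rewrite /hi mulr0 lo0 subr0.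
  by rewrite lo0 p0 q0 addrK.
- have lo1 : lo 1 = 1 by rewrite /lo mulr1 min_l // ler1n.
  have -> : hi 1 = 1 by rewrite /hi lo1; lra.
  by rewrite lo1 p1 q1 addrC addKr.
- move=> t /andP[t0 t1]; have [th|th] := lerP (2 * t) 1.
    have lot : lo t = 2 * t by rewrite /lo min_r.
    have -> : hi t = 0 by rewrite /hi lot subrr.
    by rewrite lot q0 addrK; apply: pP; lra.
  have lot : lo t = 1 by rewrite /lo min_l // ltW.
  by rewrite /hi lot p1 addrC addKr; apply: qP; lra.
Qed.

Lemma linked_segment e d z w : 0 < d <= 2^-1 ->
    (forall x y, collar x -> collar y ->
      `|x.1 - y.1| < d -> `|x.2 - y.2| < d -> forall i, `|gap i x - gap i y| < e / 2) ->
    `|z.1| = 1 -> 0 <= z.2 <= 1 -> 0 <= w.2 <= 1 -> `|z.1 - w.1| < d ->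
    `|z.2 - w.2| < d -> (forall i, `|gap i z| < e / 2) ->
  linked e z w.
Proof.
move=> /andP[d0 d2] dP z1 z2 w2 zw1 zw2 gz.
have Kz : collar z by split=> //; rewrite z1; lra.
exists (fun t => (z.1 + t *: (w.1 - z.1), z.2 + t * (w.2 - z.2))); split.
- move=> t; have c1 : z.1 + t *: (w.1 - z.1) @[t --> t] --> z.1 + t *: (w.1 - z.1).
    apply: cvgD; first exact: cvg_cst.
    by apply: cvgZ; [exact: cvg_id|exact: cvg_cst].
  have c2 : z.2 + t * (w.2 - z.2) @[t --> t] --> z.2 + t * (w.2 - z.2).
    apply: cvgD; first exact: cvg_cst.
    by apply: cvgM; [exact: cvg_id|exact: cvg_cst].
  exact: (cvg_pair c1 c2).
- by rewrite scale0r mul0r !addr0 -surjective_pairing.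
- by rewrite scale1r mul1r !(addrC z.1) !(addrC z.2) !subrK -surjective_pairing.
- move=> t /andP[t0 t1]; set x := (_, _).
  have n1 : `|z.1 - x.1| < d.
    rewrite /x /= opprD addrA subrr sub0r normrN normrZ ger0_norm //.
    by apply: le_lt_trans zw1; rewrite distrC ler_piMl.
  have n2 : `|z.2 - x.2| < d.
    rewrite /x /= opprD addrA subrr sub0r normrN normrM ger0_norm //.
    by apply: le_lt_trans zw2; rewrite distrC ler_piMl.
  have Kx : collar x.
    split.
      have := ler_dist_dist z.1 x.1; rewrite z1 => h.
      have : `|1 - `|x.1| | <= 2^-1.
        by apply: le_trans h _; apply: le_trans d2; exact: ltW.
      by rewrite ler_norml; lra.
    case/andP: z2 => z20 z21; case/andP: w2 => w20 w21; rewrite /x /=.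
    have a0 : 0 <= (1 - t) * z.2 by rewrite mulr_ge0 // subr_ge0.
    have a1 : 0 <= (1 - t) * (1 - z.2) by rewrite mulr_ge0 // subr_ge0.
    have b0 : 0 <= t * w.2 by rewrite mulr_ge0.
    have b1 : 0 <= t * (1 - w.2) by rewrite mulr_ge0 // subr_ge0.
    by apply/andP; split; lra.
  split=> // i; have h1 := gz i; have h2 := dP _ _ Kz Kx n1 n2 i.
  rewrite (_ : gap i x = gap i z - (gap i z - gap i x)); last by ring.
  by apply: le_lt_trans (ler_normB _ _) _; lra.
Qed.

End Links.

Section Crossing.
Variables (R : realType) (n : nat).
Local Notation E := 'rV[R]_n.+1.
Local Notation V := ('rV[int]_n.+1 * nat)%type.
Implicit Types (z w : E * R) (u v : V).

(** * From labels to paths *)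

Definition real_point (m : nat) v : E * R :=
  (\row_j ((v.1 0 j)%:~R / m%:R), v.2%:R / m%:R).

Lemma real_point_antipode m v : real_point m (antipode v) = mirror (real_point m v).
Proof.
by congr pair; apply/rowP => j; rewrite !mxE rmorphN mulNr.
Qed.

Lemma real_point_shell m v : (0 < m)%N -> on_shell m m v ->
  `|(real_point m v).1| = 1 /\ 0 <= (real_point m v).2 <= 1.
Proof.
move=> m0 [[vm [i vi]] v2]; have mR : 0 < m%:R :> R by rewrite ltr0n.
have c j : `|(real_point m v).1 0 j| = `|v.1 0 j|%:~R / m%:R.
  by rewrite mxE normrM normfV intr_norm (gtr0_norm mR).
split; last by rewrite divr_ge0 //= ler_pdivrMr // mul1r ler_nat.
apply/eqP; rewrite eq_le; apply/andP; split.
  apply: norm_le_coord => // j; rewrite c ler_pdivrMr // mul1r -[leRHS]/(m%:Z%:~R).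
  by rewrite ler_int.
by apply: le_trans (coord_le_norm _ i); rewrite c vi divff // gt_eqF.
Qed.

Lemma real_point_adjacent (m : nat) (d : R) u v :
    (0 < m)%N -> m%:R^-1 < d -> adjacent u v ->
  `|(real_point m u).1 - (real_point m v).1| < d /\
  `|(real_point m u).2 - (real_point m v).2| < d.
Proof.
move=> m0 md [uv uv2]; have mR : 0 < m%:R :> R by rewrite ltr0n.
have md1 : 1 / m%:R < d by rewrite mul1r.
split; apply: le_lt_trans md1.
  apply: norm_le_coord => [|j]; first by rewrite divr_ge0 // ltW.
  rewrite !mxE -mulrBl normrM normfV (gtr0_norm mR) ler_pM2r ?invr_gt0 //.
  by rewrite -rmorphB -intr_norm -[leRHS]/(1%:~R) ler_int.
rewrite /= -mulrBl normrM normfV (gtr0_norm mR) ler_pM2r ?invr_gt0 //.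
by rewrite -[u.2%:R]/(u.2%:Z%:~R) -[v.2%:R]/(v.2%:Z%:~R) -rmorphB -intr_norm
  -[leRHS]/(1%:~R) ler_int; lia.
Qed.

Section Labelling.
Variables (m : nat) (eta : R) (H : 'I_n -> E * R -> R).

(** On the surface of the cube, some coordinate has modulus m; its sign serves as
    a label where all functions H are small. *)
Definition label v : nat :=
  if [pick i | eta <= `|H i (real_point m v)|] is Some i
  then ((0 < H i (real_point m v))%R + (nat_of_ord i).*2)%N
  else if [pick j | `|v.1 0 j| == m%:Z] is Some j
  then ((0 < v.1 0 j)%R + (n + j).*2)%N else 0%N.

Hypothesis m_gt0 : (0 < m)%N.
Hypothesis eta_gt0 : 0 < eta.
Hypothesis H_odd : forall i z, H i (mirror z) = - H i z.
Hypothesis H_adjacent : forall u v, on_shell m m u -> on_shell m m v -> adjacent u v ->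
  forall i, `|H i (real_point m u) - H i (real_point m v)| < eta.

Lemma label_antipode v : on_shell m m v -> label (antipode v) = opp_label (label v).
Proof.
case=> [[_ [j0 vj0]] _]; rewrite /label real_point_antipode.
rewrite (eq_pick (Q := fun i => eta <= `|H i (real_point m v)|)); last first.
  by move=> i; rewrite H_odd normrN.
case: pickP => [i Hi|_].
  rewrite opp_label_bit H_odd oppr_gt0; congr (nat_of_bool _ + _)%N.
  by case: ltgtP => // H0; move: Hi; rewrite H0 normr0; move: eta_gt0; lra.
rewrite (eq_pick (Q := fun j => `|v.1 0 j| == m%:Z)); last first.
  by move=> j; rewrite /antipode mxE normrN.
case: pickP => [j /eqP vj|/(_ j0)]; last by rewrite vj0 eqxx.
rewrite opp_label_bit /antipode mxE oppr_gt0; congr (nat_of_bool _ + _)%N.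
by case: ltgtP => // v0; move: m_gt0; rewrite -ltz_nat -vj v0 normr0 ltxx.
Qed.

Lemma labelP v : on_shell m m v ->
  (exists2 i, eta <= `|H i (real_point m v)| &
     label v = ((0 < H i (real_point m v))%R + (nat_of_ord i).*2)%N) \/
  (exists2 j, `|v.1 0 j| = m%:Z & label v = ((0 < v.1 0 j)%R + (n + j).*2)%N).
Proof.
case=> [[_ [j0 vj0]] _]; rewrite /label.
case: pickP => [i Hi|_]; first by left; exists i.
case: pickP => [j /eqP vj|/(_ j0)]; first by right; exists j.
by rewrite vj0 eqxx.
Qed.

Lemma label_adjacent u v : on_shell m m u -> on_shell m m v -> adjacent u v ->
  (label u)./2 = (label v)./2 -> label u = label v.
Proof.
move=> uS vS uv.
case: (labelP uS) => -[i ui ->]; case: (labelP vS) => -[j vj ->];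
  rewrite !half_bit_double => ij.
- rewrite -(val_inj ij) in vj *; congr (nat_of_bool _ + _)%N.
  have := H_adjacent uS vS uv i; move: ui vj; rewrite !ler_normr !ltr_norml.
  by case: (ltrP 0 (H i _)); case: (ltrP 0 (H i _)) => //; lra.
- by have := ltn_ord i; rewrite ij ltnNge leq_addr.
- by have := ltn_ord j; rewrite -ij ltnNge leq_addr.
rewrite -(val_inj (addnI ij)) in vj *; congr (nat_of_bool _ + _)%N.
by case: uv => /(_ i) + _; move: ui vj; lia.
Qed.

Lemma label_good v : (n <= (label v)./2)%N -> on_shell m m v ->
  forall i, `|H i (real_point m v)| < eta.
Proof.
move=> + vS; rewrite /label; case: pickP => [i _|noi _ i].
  by rewrite half_bit_double leqNgt ltn_ord.
by rewrite ltNge noi.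
Qed.

End Labelling.

Variables (n_ge1 : (1 <= n)%N) (f : 'I_n -> E -> R) (N : E).
Let i0 : 'I_n := Ordinal n_ge1.
Hypothesis NN : dot N N = 1.
Hypothesis f_cont : forall i, {within sphere R n, continuous (f i)}.
Hypothesis N_max : forall x : E, sphere R n x -> f i0 x <= f i0 N.

(** At t = 1 the member of the pair on the positive side of N is N itself; as f is
    maximal at N, the gap has the sign of the inner product of N and y. *)
Lemma gap_end d y : y != 0 -> 0 < d ->
  d * `|dot N y| <= `|gap N f i0 (y, 1) + d * dot N y|.
Proof.
move=> y0 d0; have en := eucl_norm_gt0 y0.
have tS z : z.1 != 0 -> z.2 = 1 -> f i0 (tip N z) <= f i0 N.
  by move=> z0 z1; apply/N_max/tip_sphere; rewrite // z1 ler01 lexx.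
have [c0|c0] := lerP 0 (dot N y).
  have g0 : 0 <= gap N f i0 (y, 1).
    rewrite /gap tip1 ?subr_ge0 ?tS //= ?oppr_eq0 //.
    by rewrite dotZr mulr_ge0 // invr_ge0 ltW.
  by rewrite (ger0_norm c0) ger0_norm ?lerDr // addr_ge0 // mulr_ge0 // ltW.
have g0 : gap N f i0 (y, 1) <= 0.
  rewrite /gap [tip N (mirror _)]tip1 ?subr_le0 ?tS //=.
  by rewrite dotZr dotNr mulr_ge0 // ?invr_ge0 ?oppr_ge0 ltW // eucl_normN.
have dc : d * dot N y < 0 by rewrite pmulr_rlt0.
by rewrite ltr0_norm // ler0_norm; lra.
Qed.

(** The lattice must be fine enough for two purposes: H varies by less than eta
    along an edge, so that neighbours never get opposite labels, and the gap
    varies by less than e / 2, so that an edge between near-zeros is a link. *)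
Lemma crossing e : 0 < e -> exists y y' : E,
  [/\ `|y| = 1, dot N y' = 0 & linked N f e (y, 0) (y', 1)].
Proof.
move=> e0; have [C C0 NC] := dot_bound N.
(* With this weight, the added term is at most e / 4 on the unit sphere of the sup
   norm. *)
pose d := e / (4 * C).
have d0 : 0 < d by rewrite divr_gt0 // mulr_gt0.
have e2 : 0 < e / 2 by rewrite divr_gt0.
have [rho rho2 rhoP] := modulus (gap_continuous NN f_cont) e2.
have /andP[rho0 _] := rho2.
(* If |H| < eta at the end of the chain, then N and y are so close to orthogonal
   that projecting y along N moves it by less than rho. *)
pose eta := Num.min (e / 4) (d * (rho / (`|N| + 1))).
have N1 : 0 < `|N| + 1 by rewrite ltr_wpDl.
have eta0 : 0 < eta by rewrite lt_min !divr_gt0 //= mulr_gt0 // divr_gt0.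
pose H i z := gap N f i z + (i == i0)%:R * (d * dot N z.1).
have H_cont i : {within @collar R n, continuous (H i)}.
  apply/subspace_continuousP => z Kz; apply: cvgD.
    by move/subspace_continuousP: (gap_continuous NN f_cont (i := i)); apply.
  apply: cvg_within_filter; apply: cvgM; first exact: cvg_cst.
  apply: cvgM; first exact: cvg_cst.
  apply: (@continuous_comp _ _ _ (fst : E * R -> E) (dot N)); first exact: cvg_fst.
  exact: dot_continuous.
have [r /andP[r0 _] rP] := modulus H_cont eta0.
pose m0 := Num.truncn (Num.min r rho)^-1; pose m := m0.+1.
have rm : m%:R^-1 < Num.min r rho.
  by rewrite invf_plt ?posrE ?ltr0n ?lt_min ?r0 ?rho0 // truncnS_gt.
move: rm; rewrite lt_min => /andP[rm rhom].
have shell_collar v : on_shell m m v -> collar (real_point m v).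
  move=> /real_point_shell[//|v1 v2]; split=> //; rewrite v1; lra.
have H_odd i z : H i (mirror z) = - H i z.
  by rewrite /H gap_mirror /= dotNr; ring.
have H_adjacent u v : on_shell m m u -> on_shell m m v -> adjacent u v ->
    forall i, `|H i (real_point m u) - H i (real_point m v)| < eta.
  move=> /shell_collar uK /shell_collar vK uv i.
  by have [h1 h2] := real_point_adjacent (ltn0Sn m0) rm uv; apply: rP.
have good v : on_shell m m v -> (n <= (label m eta H v)./2)%N ->
    (forall i, `|H i (real_point m v)| < eta) /\
    (forall i, `|gap N f i (real_point m v)| < e / 2).
  move=> vS vn; have Hv := label_good vn vS; split=> // i.
  have [v1 _] := real_point_shell (ltn0Sn m0) vS.
  have dC : `|(i == i0)%:R * (d * dot N (real_point m v).1)| <= e / 4.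
    have : `|d * dot N (real_point m v).1| <= e / 4.
      have <- : d * C = e / 4 by rewrite /d; field; rewrite gt_eqF.
      rewrite normrM (gtr0_norm d0) ler_pM2l //.
      by have := NC (real_point m v).1; rewrite v1 mulr1.
    by case: (i == i0); rewrite ?mul1r // mul0r normr0 => _; rewrite divr_ge0 // ltW.
  have Hi : `|H i (real_point m v)| < e / 4.
    by apply: lt_le_trans (Hv i) _; rewrite ge_min lexx.
  rewrite (_ : gap N f i _ = H i (real_point m v)
    - (i == i0)%:R * (d * dot N (real_point m v).1)); last by rewrite /H addrK.
  by apply: le_lt_trans (ler_normB _ _) _; lra.
have [v vR v2] := reachable_top (label_antipode (ltn0Sn m0) eta0 H_odd)
  (label_adjacent (ltn0Sn m0) eta0 H_adjacent).
have [vS [[Hv gv] [y [y1 yv]]]] : on_shell m m v /\ 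
   (((forall i, `|H i (real_point m v)| < eta) /\
    (forall i, `|gap N f i (real_point m v)| < e / 2)) /\
   exists y, `|y| = 1 /\ linked N f e (y, 0) (real_point m v)).
  elim: vR {v2} => {v} [v vS v0 vn|u v _ [uS [[Hu gu] [y [y1 yu]]]] uv vS vn].
    split=> //; have [Hv gv] := good _ vS vn; split=> //.
    exists (real_point m v).1; split; first by case: (real_point_shell (ltn0Sn m0) vS).
    have -> : ((real_point m v).1, 0) = real_point m v.
      by rewrite {2}/real_point v0 mul0r.
    apply: linked_refl => [|i]; first exact: shell_collar.
    by apply: lt_le_trans (gv i) _; rewrite ler_pdivrMr // ler_peMr ?ltW // ltr1n.
  split=> //; split; first exact: good.
  exists y; split=> //; apply: linked_trans yu _.
  have [u1 u01] := real_point_shell (ltn0Sn m0) uS.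
  have [_ v01] := real_point_shell (ltn0Sn m0) vS.
  have [uv1 uv2] := real_point_adjacent (ltn0Sn m0) rhom uv.
  exact: linked_segment rho2 rhoP u1 u01 v01 uv1 uv2 gu.
have Ny : `|dot N (real_point m v).1| * (`|N| + 1) < rho.
  have := gap_end (collar_neq0 (shell_collar _ vS)) d0.
  have -> : (((real_point m v).1, 1) : E * R) = real_point m v.
    by rewrite {2}/real_point v2 divff // pnatr_eq0.
  have := Hv i0; rewrite {1}/H eqxx mul1r => h1 h2.
  have := le_lt_trans h2 h1; rewrite lt_min => /andP[_].
  by rewrite ltr_pM2l // ltr_pdivlMr.
have [v1 _] := real_point_shell (ltn0Sn m0) vS.
have vE : real_point m v = ((real_point m v).1, 1).
  by rewrite {1}/real_point v2 divff // pnatr_eq0.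
set x := (real_point m v).1 in Ny v1 vE.
exists y, (x - dot N x *: N); split=> //.
  by rewrite dotDr dotNr dotZr NN mulr1 subrr.
apply: linked_trans yv _; rewrite vE.
apply: linked_segment rho2 rhoP _ _ _ _ _ _ => //=;
  rewrite ?ler01 ?lexx ?subrr ?normr0 //.
  rewrite opprD addrA subrr sub0r opprK normrZ; apply: le_lt_trans Ny.
  by rewrite ler_wpM2l // lerDl.
by rewrite -vE.
Qed.

End Crossing.

Theorem theorem4 (R : realType) (n : nat) (n_ge1 : (1 <= n)%N)
    (f : 'I_n -> 'rV[R]_n.+1 -> R)
    (f_cont : forall i, {within sphere R n, continuous (f i)}) :
  exists x : 'rV[R]_n.+1,
    [/\ sphere R n x,
        (forall i, f i x = f i (- x)) &
        forall eps : R, 0 < eps ->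
          exists a b : R -> 'rV[R]_n.+1,
            [/\ path_in (sphere R n) a /\ path_in (sphere R n) b,
                a 0 = x, b 0 = - x, a 1 = b 1 &
                forall t, `[0, 1] t ->
                  forall i, `|f i (a t) - f i (b t)| < eps]].
Proof.
pose E := 'rV[R]_n.+1.
have cS : compact (sphere R n).
  apply: bounded_closed_compact.
    exists 1; split; first exact: num_real.
    by move=> M M1 x Sx; apply: le_trans (norm_le_eucl x) _; rewrite Sx ltW.
  have -> : sphere R n = @eucl_norm R n.+1 @^-1` [set 1] by [].
  apply: closed_comp; last exact: closed_eq.
  by move=> x _; exact: eucl_norm_continuous.
have [N NS N_max] : exists2 N, sphere R n N &
    forall x, sphere R n x -> f (Ordinal n_ge1) x <= f (Ordinal n_ge1) N.
  have [|N NS NP] := compact_EVT_max _ cS (f_cont (Ordinal n_ge1)).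
    exists (delta_mx 0 0); apply: sphere_dot; rewrite /dot (bigD1 ord0) //= big1.
      by rewrite !mxE !eqxx mulr1 addr0.
    by move=> i i0; rewrite !mxE (negbTE i0) andbF mulr0.
  exists N; first by rewrite inE in NS.
  by move=> x Sx; apply: NP; rewrite inE.
have NN : dot N N = 1.
  by rewrite -[LHS]sqr_sqrtr ?dot_ge0 // -eucl_normE (NS : eucl_norm N = 1) expr1n.
pose e_ k : R := k.+1%:R^-1.
have e0 k : 0 < e_ k by rewrite invr_gt0 ltr0n.
have [y_ /all_sig[y'_ yP]] : {y_ : nat -> E & forall k, {y' : E |
    [/\ `|y_ k| = 1, dot N y' = 0 & linked N f (e_ k) (y_ k, 0) (y', 1)]}}.
  have /choice[z zP] : forall k, exists z : E * E,
      [/\ `|z.1| = 1, dot N z.2 = 0 & linked N f (e_ k) (z.1, 0) (z.2, 1)].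
    move=> k; have [y [y' yP]] := crossing NN f_cont N_max (e0 k).
    by exists (y, y').
  by exists (fun k => (z k).1) => k; exists (z k).2.
(* The starting points of the crossings for e = 1 / (k + 1) accumulate at some y. *)
have [y [y1 ycl]] : [set y : E | `|y| = 1] `&` cluster (y_ @ \oo) !=set0.
  have : compact [set y : E | `|y| = 1].
    apply: bounded_closed_compact.
      exists 1; split; first exact: num_real.
      by move=> M M1 x /= ->; exact: ltW.
    have -> : [set y : E | `|y| = 1] = Num.norm @^-1` [set 1] by [].
    apply: closed_comp; last exact: closed_eq.
    by move=> x _; exact: norm_continuous.
  by apply; exists 0 => // k _ /=; have [] := yP k.
have y0 : y != 0 by rewrite -normr_gt0 y1.
have near_y e : 0 < e -> exists d, exists k, [/\ 0 < d <= 2^-1, e_ k < e / 2,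
    `|y - y_ k| < d & forall x z, collar x -> collar z ->
      `|x.1 - z.1| < d -> `|x.2 - z.2| < d ->
      forall i, `|gap N f i x - gap N f i z| < e / 2].
  move=> epos; have e2 : 0 < e / 2 by rewrite divr_gt0.
  have [d d2 dP] := modulus (gap_continuous NN f_cont) e2.
  have /andP[d0 _] := d2.
  have small : (y_ @ \oo) [set y_ k | k in [set k | e_ k < e / 2]].
    exists (Num.truncn (e / 2)^-1) => // k /= ek; exists k => //=.
    rewrite /e_ invf_plt ?posrE ?ltr0n //.
    by apply: lt_le_trans (truncnS_gt _) _; rewrite ler_nat.
  have [_ [[k /= ke <-] yk]] := ycl _ _ small (nbhsx_ballx y d d0).
  exists d, k; split=> //.
  by move: yk; rewrite -ball_normE.
have collar_y z : `|z| = 1 -> collar ((z, 0) : E * R).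
  by move=> z1; split; rewrite /= ?z1 ?lexx ?ler01 //; lra.
have gap0 i : gap N f i (y, 0) = 0.
  apply/eqP; rewrite -normr_le0; apply/ler_addgt0Pl => e epos; rewrite addr0.
  have [d [k [/andP[d0 d2] ke yk dP]]] := near_y e epos.
  have [yk1 _ [p [_ p0 _ /(_ 0)]]] := yP k.
  rewrite lexx ler01 p0 => /(_ isT)[_ /(_ i) gk].
  have := dP _ _ (collar_y _ y1) (collar_y _ yk1) yk _ i.
  rewrite /= subrr normr0 => /(_ d0) gd.
  rewrite (_ : gap N f i (y, 0) = gap N f i (y_ k, 0) +
    (gap N f i (y, 0) - gap N f i (y_ k, 0))); last by ring.
  by apply: le_trans (ler_normD _ _) _; lra.
have tipy : tip N (y, 0) = unit_vec y by exact: tip0.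
have tipNy : tip N (mirror (y, 0)) = - unit_vec y.
  by rewrite /mirror /= tip0 ?oppr_eq0 // unit_vecN.
exists (unit_vec y); split; first exact/sphere_dot/dot_unit.
  by move=> i; have := gap0 i; rewrite /gap tipy tipNy => /subr0_eq.
move=> e epos; have [d [k [d2 ke yk dP]]] := near_y e epos.
have /andP[d0 _] := d2.
have [_ Ny' yk_linked] := yP k.
have [p [cp p0 p1 pP]] : linked N f e (y, 0) (y'_ k, 1).
  apply: linked_trans (linked_le _ yk_linked); last by move: ke; lra.
  apply: linked_segment d2 dP _ _ _ _ _ _ => //=; rewrite ?lexx ?ler01 //.
    by rewrite subrr normr0.
  by move=> i; rewrite gap0 normr0 divr_gt0.
have tip_path (h : E * R -> E * R) : continuous h ->
    (forall z, collar z -> collar (h z)) ->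
    path_in (sphere R n) (tip N \o h \o p).
  move=> ch hK; split=> [|t]; last first.
    rewrite /= in_itv /= => /pP[Kt _]; have Kh := hK _ Kt.
    by apply: tip_sphere => //; [exact: collar_neq0|case: Kh].
  apply: continuous_in_subspaceT => t; rewrite inE /= in_itv /= => /pP[Kt _].
  apply: continuous_comp; first exact: cp.
  apply: continuous_comp; first exact: ch.
  by apply: tip_continuous; apply: collar_neq0; exact: hK.
exists (tip N \o p), (tip N \o @mirror R n \o p); split.
- split; first by apply: (tip_path id) => // z; exact: cvg_id.
  by apply: tip_path => [|z]; [exact: mirror_continuous|exact: collar_mirror].
- by rewrite /= p0.
- by rewrite /= p0.
- have c0 : dot N (unit_vec (y'_ k)) = 0 by rewrite dotZr Ny' mulr0.
  by rewrite /= p1 /mirror /= !tip1 ?unit_vecN ?dotNr ?c0 ?oppr0.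
- by move=> t; rewrite /= in_itv /= => /pP[_].
Qed.
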